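(* Let $A$ be a real $m\times n$ matrix and $B$ a real $n\times\rho$ matrix, let $\Theta^{(\kappa)}=\{\Theta^{(\kappa)}_1,\ldots,\Theta^{(\kappa)}_k\}$ be a partition of $\{1,\ldots,n\}$ with $|\Theta^{(\kappa)}|=k$, and let $c\ge1$ be an integer. For every sampling probability $p=(p_\ell)_{\ell=1}^k$, the estimator $$\hat S=\frac1c\sum_{i=1}^c\frac1{p_{r_i}}A_{(,\Theta^{(\kappa)}_{r_i})}B_{(\Theta^{(\kappa)}_{r_i},)},$$ where $r_1,\ldots,r_c$ are independent samples from $\{1,\ldots,k\}$ drawn according to $p$, satisfies $$\mathbb{E}_p\big[\|AB-\hat S\|_F^2\big]=\frac1c\sum_{\ell=1}^k\frac1{p_\ell}\big\|A_{(,\Theta^{(\kappa)}_\ell)}B_{(\Theta^{(\kappa)}_\ell,)}\big\|_F^2-\frac{\|AB\|_F^2}{c}.$$ Moreover, assuming $A_{(,\Theta^{(\kappa)}_\ell)}B_{(\Theta^{(\kappa)}_\ell,)}\neq0$ for all $1\le\ell\le k$, the sampling probability minimizing $\mathbb{E}_p[\|AB-\hat S\|_F^2]$ over all sampling probabilities $p$ is $p^{(\kappa)}=(p^{(\kappa)}_\ell)_{\ell=1}^k$ given by $$p^{(\kappa)}_\ell=\frac{\big\|A_{(,\Theta^{(\kappa)}_\ell)}B_{(\Theta^{(\kappa)}_\ell,)}\big\|_F}{\sum_{j=1}^k\big\|A_{(,\Theta^{(\kappa)}_j)}B_{(\Theta^{(\kappa)}_j,)}\big\|_F},\qquad 1\le\ell\le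 k,$$ and the corresponding expected squared error is $$\mathbb{E}_{p^{(\kappa)}}\big[\|AB-\hat S\|_F^2\big]=\frac1c\Big(\sum_{\ell=1}^k\big\|A_{(,\Theta^{(\kappa)}_\ell)}B_{(\Theta^{(\kappa)}_\ell,)}\big\|_F\Big)^2-\frac{\|AB\|_F^2}{c}.$$
   Context: A partition of $\{1,\ldots,n\}$ is into nonempty disjoint blocks $\Theta^{(\kappa)}_\ell$ of indices. A sampling probability on a partition with $k$ blocks is a vector $p=(p_\ell)_{\ell=1}^k$ with all $p_\ell>0$ and $\sum_{\ell=1}^k p_\ell=1$; index $\ell$ is drawn with probability $p_\ell$. $A_{(,\Theta^{(\kappa)}_\ell)}$ is the $m\times|\Theta^{(\kappa)}_\ell|$ matrix formed by the columns of $A$ with indices in $\Theta^{(\kappa)}_\ell$, and $B_{(\Theta^{(\kappa)}_\ell,)}$ is the $|\Theta^{(\kappa)}_\ell|\times\rho$ matrix formed by the rows of $B$ with indices in $\Theta^{(\kappa)}_\ell$ (same ordering of indices). $\|\cdot\|_F$ is the Frobenius norm and $\mathbb{E}_p$ denotes expectation under $p$. *)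

(* Defs.v *)
From HB Require Import structures.
From mathcomp Require Import all_boot all_order all_algebra.
From mathcomp Require Import all_classical all_reals all_analysis.

Set Implicit Arguments.
Unset Strict Implicit.
Unset Printing Implicit Defensive.

Import Order.TTheory GRing.Theory Num.Theory.
Import numFieldNormedType.Exports.

Local Open Scope classical_set_scope.
Local Open Scope ring_scope.

(* A partition of {1, ..., n} into k blocks, with its blocks labelled by 'I_k.
   Without injectivity a block could carry several labels. *)
Definition labelled_partition (n k : nat) (Theta : 'I_k -> {set 'I_n}) : Prop :=
  injective Theta /\
  finset.partition [set Theta l | l in 'I_k]%SET [set: 'I_n]%SET.

(* [enum_val] lists a block in increasing order, so the columns of A and the
   rows of B are taken in the same order. *)
Definition col_block (R : Type) (m n : nat) (S : {set 'I_n}) (A : 'M[R]_(m, n)) :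
  'M[R]_(m, #|S|) := colsub (@enum_val _ (mem S)) A.

Definition row_block (R : Type) (n rho : nat) (S : {set 'I_n}) (B : 'M[R]_(n, rho)) :
  'M[R]_(#|S|, rho) := rowsub (@enum_val _ (mem S)) B.

Definition block_mul (R : realType) (m n rho : nat) (S : {set 'I_n})
    (A : 'M[R]_(m, n)) (B : 'M[R]_(n, rho)) : 'M[R]_(m, rho) :=
  col_block S A *m row_block S B.

(* The norm the library puts on matrices is the maximum norm. *)
Definition frobenius (R : realType) (m n : nat) (M : 'M[R]_(m, n)) : R :=
  Num.sqrt (\sum_(i < m) \sum_(j < n) M i j ^+ 2).

Definition sampling_prob (R : realType) (k : nat) (p : {ffun 'I_k -> R}) : Prop :=
  (forall l, 0 < p l) /\ \sum_(l < k) p l = 1.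

Section samples.
Context d (Omega : measurableType d) (R : realType).
Variables (P : probability Omega R) (c k : nat) (r : 'I_c -> Omega -> 'I_k).

(* Measurability for the discrete sigma-algebra on 'I_k. *)
Definition measurable_samples : Prop :=
  forall (i : 'I_c) (E : set 'I_k), measurable (r i @^-1` E).

Definition mutually_independent : Prop :=
  forall (J : {set 'I_c}) (E : 'I_c -> set 'I_k),
    P (\bigcap_(i in [set` J]) (r i @^-1` E i)) =
    (\prod_(i in J) P (r i @^-1` E i))%E.

Definition iid_samples (p : {ffun 'I_k -> R}) : Prop :=
  [/\ measurable_samples,
      forall i l, P (r i @^-1` [set l]) = (p l)%:E
    & mutually_independent].

End samples.

(* For every sampling probability i.i.d. samples exist, so statements about all
   [r] with [iid_samples P r p] are not vacuous. *)
Section existence.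
Variables (R : realType) (c k : nat) (p : {ffun 'I_k -> R}) (l0 : 'I_k).
Hypothesis pP : sampling_prob p.

Let S : finType := {ffun 'I_c -> 'I_k}.
Let s0 : S := [ffun=> l0].
Let outcome (x : nat) : S := nth s0 (enum S) x.
Let weight (s : S) : R := \prod_(i < c) p (s i).

Let weight_ge0 s : 0 <= weight s.
Proof. by apply: prodr_ge0 => i _; apply/ltW; case: pP. Qed.

Let mu : {measure set nat -> \bar R} := msum (fun j => mscale (NngNum (weight_ge0 (outcome j))) \d_j) #|S|.

Let muE (Q : pred S) :
  mu [set x | Q (outcome x)] = (\sum_(s | Q s) weight s)%:E.
Proof.
transitivity (\sum_(j < #|S|) (weight (outcome j) *
    ((j : nat) \in [set x | Q (outcome x)])%:R)%:E)%E.
  by apply: eq_bigr => j _; rewrite EFinM.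
transitivity (\sum_(j < #|S|)
    (if Q (enum_val j) then weight (enum_val j) else 0)%:E)%E.
  apply: eq_bigr => j _; congr EFin.
  have oj : outcome j = enum_val j by rewrite (enum_val_nth s0).
  rewrite oj; case: ifPn => Qj; first by rewrite mem_set ?mulr1//= oj.
  by rewrite memNset ?mulr0//= oj; apply/negP.
rewrite sumEFin; congr EFin; rewrite [RHS]big_mkcond/=.
by rewrite [RHS](reindex_onto (@enum_val S S) enum_rank) => [|s _];
  rewrite ?enum_rankK//; apply: eq_bigl => j; rewrite enum_valK eqxx.
Qed.

Let boxE (J : {set 'I_c}) (E : 'I_c -> pred 'I_k) :
  \sum_(s : S | [forall i in J, E i (s i)]) weight s =
  \prod_(i in J) \sum_(l | E i l) p l.
Proof.
rewrite [RHS]big_mkcond/=.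
pose F i : pred 'I_k := fun l => (i \in J) ==> E i l.
transitivity (\prod_(i < c) \sum_(l | F i l) p l); last first.
  by apply: eq_bigr => i _; rewrite /F; case: ifP => // _; case: pP.
rewrite (bigA_distr_big_dep _ (fun i l => p l))/=.
by apply: eq_bigl => s; apply/forall_inP/familyP => h i;
  [apply/implyP/h | exact/implyP/h].
Qed.

Let mu_setT : mu [set: nat] = 1%E.
Proof.
apply: (@etrans _ _ (mu [set x | xpredT (outcome x)])).
  by congr (mu _); apply/seteqP; split.
apply: (etrans (muE xpredT)); rewrite -(bigA_distr_bigA (fun (i : 'I_c) l => p l)).
by rewrite big1// => i _; case: pP.
Qed.

Let mu_box (J : {set 'I_c}) (E : 'I_c -> set 'I_k) :
  mu (\bigcap_(i in [set` J]) ((fun x => outcome x i) @^-1` E i)) =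
  (\prod_(i in J) \sum_(l | l \in E i) p l)%:E.
Proof.
rewrite -(boxE J (fun i l => l \in E i)) -muE; congr (mu _).
apply/seteqP; split=> x /= h.
  by apply/forall_inP => i iJ; apply/mem_set/h.
by move=> i iJ; move/forall_inP : h => /(_ i iJ)/set_mem.
Qed.

Let mu_preim i (E : set 'I_k) :
  mu ((fun x => outcome x i) @^-1` E) = (\sum_(l | l \in E) p l)%:E.
Proof.
have := mu_box [set i]%SET (fun=> E); rewrite big_set1 => <-; congr (mu _).
apply/seteqP; split=> x /= h; last by apply: h; rewrite /= inE.
by move=> j; rewrite /= inE => /eqP ->.
Qed.

Lemma iid_samples_witness :
  exists (P : probability nat R) (r : 'I_c -> nat -> 'I_k), iid_samples P r p.
Proof.
pose prM := Measure_isProbability.Build _ _ R mu mu_setT.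
pose P : probability nat R := HB.pack (Measure.sort mu) prM.
exists P, (fun i x => outcome x i); split=> // [i l|J E].
  rewrite mu_preim (big_pred1 l)// => l'.
  by apply/idP/eqP => [/set_mem//|->]; rewrite inE.
rewrite mu_box -prodEFin; apply: eq_bigr => i _; exact/esym/mu_preim.
Qed.

End existence.

Lemma iid_samples_exist (R : realType) (c k : nat) (p : {ffun 'I_k -> R}) :
  sampling_prob p ->
  exists (P : probability nat R) (r : 'I_c -> nat -> 'I_k), iid_samples P r p.
Proof.
case: k p => [|k] p pP; last exact: (iid_samples_witness c ord0 pP).
by case: pP => _; rewrite big_ord0 => /esym/eqP; rewrite oner_eq0.
Qed.

Definition estimator (R : realType) (m n rho k c : nat)
    (A : 'M[R]_(m, n)) (B : 'M[R]_(n, rho)) (Theta : 'I_k -> {set 'I_n})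
    (p : {ffun 'I_k -> R}) (s : 'I_c -> 'I_k) : 'M[R]_(m, rho) :=
  c%:R^-1 *: \sum_(i < c) (p (s i))^-1 *: block_mul (Theta (s i)) A B.

(* E_p [ ||A B - S||_F^2 ], for samples r drawn on the probability space
   (Omega, P); the subscript p enters through [iid_samples P r p]. *)
Definition expected_sq_error d (Omega : measurableType d) (R : realType)
    (P : probability Omega R) (m n rho k c : nat)
    (A : 'M[R]_(m, n)) (B : 'M[R]_(n, rho)) (Theta : 'I_k -> {set 'I_n})
    (p : {ffun 'I_k -> R}) (r : 'I_c -> Omega -> 'I_k) : \bar R :=
  'E_P[(fun w => frobenius (A *m B - estimator A B Theta p (r ^~ w)) ^+ 2)].

Definition optimal_prob (R : realType) (m n rho k : nat)
    (A : 'M[R]_(m, n)) (B : 'M[R]_(n, rho)) (Theta : 'I_k -> {set 'I_n}) :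
    {ffun 'I_k -> R} :=
  [ffun l => frobenius (block_mul (Theta l) A B) /
             \sum_(j < k) frobenius (block_mul (Theta j) A B)].

(* Main.v *)
Require Import Defs.
From HB Require Import structures.
From mathcomp Require Import all_boot all_order all_algebra.
From mathcomp Require Import all_classical all_reals all_analysis.
From mathcomp Require Import ring.

Import Order.TTheory GRing.Theory Num.Theory.
Import numFieldNormedType.Exports.

Local Open Scope classical_set_scope.
Local Open Scope ring_scope.

(** Since the blocks partition the indices, [A *m B] is the sum of the block
    products C_l, so each term C_{r_i} / p_{r_i} of the estimator has mean
    [A *m B]: every entry of the error is the average of [c] independent
    centred variables.  Cross terms of distinct samples therefore vanish in the
    expected square, which is the variance of a single sample divided by [c];
    summing sum_l C_l^2 / p_l - (sum_l C_l)^2 over the entries gives the error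
    formula ([expected_sq_errorE]).  The expectation is first turned into a
    finite sum over all sample vectors, weighted by the product of the
    probabilities of their coordinates ([expectation_iid_samples]).

    For the optimum, put f_l = |C_l|_F and F = sum_l f_l.  Only
    sum_l f_l^2 / p_l depends on p, and the same variance identity
    ([importance_variance]), now applied to the numbers f_l, reads
    sum_l f_l^2 / p_l - F^2 = sum_l p_l (F - f_l / p_l)^2.  The right-hand side
    is nonnegative and vanishes exactly when p_l = f_l / F for all l, so the
    minimum is F^2 and has a single minimiser. *)

Lemma frobenius_sq (R : realType) (m n : nat) (M : 'M[R]_(m, n)) :
  frobenius M ^+ 2 = \sum_(i < m) \sum_(j < n) M i j ^+ 2.
Proof.
by rewrite sqr_sqrtr//; do 2![apply: sumr_ge0 => ? _]; apply: sqr_ge0.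
Qed.

Lemma frobenius_gt0 (R : realType) (m n : nat) (M : 'M[R]_(m, n)) :
  M <> 0 -> 0 < frobenius M.
Proof.
move=> M0; rewrite lt_def sqrtr_ge0 andbT -sqrf_eq0 frobenius_sq.
apply/eqP => S0; apply: M0; apply/matrixP => i j; rewrite mxE.
have /(psumr_eq0P _)/(_ i isT) Si : \sum_i \sum_j M i j ^+ 2 = 0 := S0.
have /(psumr_eq0P _)/(_ j isT)/eqP : \sum_j M i j ^+ 2 = 0.
  by apply: Si => k _; apply: sumr_ge0 => l _; apply: sqr_ge0.
by rewrite sqrf_eq0 => /(_ (fun k _ => sqr_ge0 _))/eqP.
Qed.

Lemma sum_block_mul (R : realType) (m n rho k : nat)
    (A : 'M[R]_(m, n)) (B : 'M[R]_(n, rho)) (Theta : 'I_k -> {set 'I_n}) :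
  labelled_partition Theta ->
  \sum_(l < k) block_mul (Theta l) A B = A *m B.
Proof.
case=> Theta_inj /and3P[/eqP covT tiT _].
apply/matrixP => a b; rewrite summxE mxE.
pose F (j : 'I_n) := A a j * B j b.
transitivity (\sum_(l in 'I_k) \sum_(j in Theta l) F j).
  apply: eq_bigr => l _; rewrite mxE [RHS]big_enum_val.
  by apply: eq_bigr => i _; rewrite !mxE.
rewrite -(big_imset (fun S : {set 'I_n} => \sum_(j in S) F j)); last first.
  by move=> l l' _ _; apply: Theta_inj.
rewrite -finset.big_trivIset//= covT.
by apply: eq_bigl => j; rewrite finset.in_setT.
Qed.

(** A function of the samples takes finitely many values: it is a combination
    of indicators of the events that the sample vector equals [s], and
    independence makes the probability of such an event a product. *)
Lemma expectation_iid_samples (d : measure_display) (Omega : measurableType d)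
    (R : realType) (P : probability Omega R) (c k : nat)
    (r : 'I_c -> Omega -> 'I_k) (p : {ffun 'I_k -> R})
    (f : ('I_c -> 'I_k) -> R) :
  iid_samples P r p ->
  ('E_P[fun w => f (r ^~ w)] =
  (\sum_(s : {ffun 'I_c -> 'I_k}) (\prod_(i < c) p (s i)) * f s)%R%:E)%E.
Proof.
case=> mr rp indep.
pose box (s : {ffun 'I_c -> 'I_k}) : set Omega :=
  \bigcap_(i in [set` [set: 'I_c]%SET]) (r i @^-1` [set s i]).
have mbox s : measurable (box s).
  by apply: fin_bigcap_measurable => // i _; apply: mr.
have Pbox s : P (box s) = (\prod_(i < c) p (s i))%:E.
  rewrite indep -prodEFin; under eq_bigl do rewrite finset.in_setT.
  by apply: eq_bigr => i _; apply: rp.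
(* The sample vector at [w] lies in exactly one box. *)
have boxE s w : \1_(box s) w = (s == [ffun i => r i w])%:R :> R.
  rewrite indicE; congr (_%:R); congr nat_of_bool; apply/idP/eqP => [/set_mem sw|->].
    by apply/ffunP => i; rewrite ffunE; apply/esym/sw; rewrite /= finset.in_setT.
  by apply/mem_set => i _ /=; rewrite ffunE.
have fE w : (f (r ^~ w))%:E =
    (\sum_(s : {ffun 'I_c -> 'I_k}) (f s)%:E * (\1_(box s) w)%:E)%E.
  rewrite (bigD1 [ffun i => r i w])//= boxE eqxx mule1 big1 ?adde0.
    by congr (f _)%:E; apply/funext => i; rewrite ffunE.
  by move=> s /negPf sr; rewrite boxE sr mule0.
have ibox s : P.-integrable setT (EFin \o \1_(box s)).
  by apply: integrable_indic; rewrite // setTI.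
rewrite unlock; under eq_integral do rewrite fE.
rewrite integral_sum//; last by move=> s; apply: (integrableZl measurableT (f s) (ibox s)).
rewrite -sumEFin; apply: eq_bigr => s _.
rewrite (integralZl measurableT (ibox s)) integral_indic// setIT.
by rewrite [X in (_ * X)%E](Pbox s) -EFinM mulrC.
Qed.

(** Independence in finite form: the weighted sum factors over the
    coordinates.  For distinct [i] and [j] the [i]-th factor is the mean of
    [y], which is zero; for [i = j] it is the second moment of [y]. *)
Lemma sum_prod_pair (R : realType) (c k : nat) (p : {ffun 'I_k -> R})
    (y : 'I_k -> R) (i j : 'I_c) :
  \sum_l p l = 1 -> \sum_l p l * y l = 0 ->
  \sum_(s : {ffun 'I_c -> 'I_k}) (\prod_(t < c) p (s t)) * (y (s i) * y (s j)) =
  if i == j then \sum_l p l * y l ^+ 2 else 0.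
Proof.
move=> p1 py0.
(* Spreading [y (s i) * y (s j)] over all coordinates, with factor 1 away
   from [i] and [j], makes the summand a product over coordinates. *)
pose w (t : 'I_c) (l : 'I_k) : R :=
  p l * ((if t == i then y l else 1) * (if t == j then y l else 1)).
have pick1 (s : {ffun 'I_c -> 'I_k}) (u : 'I_c) :
    \prod_(t < c) (if t == u then y (s t) else 1) = y (s u).
  by rewrite -big_mkcond big_pred1_eq.
transitivity (\sum_(s : {ffun 'I_c -> 'I_k}) \prod_(t < c) w t (s t)).
  by apply: eq_bigr => s _; rewrite !big_split/= !pick1.
rewrite -(bigA_distr_bigA w) (bigD1 i)//= {1}/w eqxx.
case: (eqVneq i j) => [ij|ij].
  rewrite [X in _ * X]big1 ?mulr1// => t /negPf ti.
  rewrite -[RHS]p1.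
  by apply: eq_bigr => l _; rewrite /w -ij ti !mulr1.
rewrite [X in X * _](_ : _ = 0) ?mul0r// -[RHS]py0.
by apply: eq_bigr => l _; rewrite mulr1.
Qed.

(** Variances of independent centred variables add up. *)
Lemma sum_prod_sq_sum (R : realType) (c k : nat) (p : {ffun 'I_k -> R})
    (y : 'I_k -> R) :
  \sum_l p l = 1 -> \sum_l p l * y l = 0 ->
  \sum_(s : {ffun 'I_c -> 'I_k})
    (\prod_(t < c) p (s t)) * (\sum_(i < c) y (s i)) ^+ 2 =
  c%:R * \sum_l p l * y l ^+ 2.
Proof.
move=> p1 py0.
under eq_bigr do rewrite expr2 big_distrlr mulr_sumr.
rewrite exchange_big/=.
transitivity (\sum_(i < c) \sum_l p l * y l ^+ 2); last first.
  by rewrite sumr_const card_ord mulr_natl.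
apply: eq_bigr => i _; under eq_bigr do rewrite mulr_sumr.
rewrite exchange_big/=.
under eq_bigr do rewrite sum_prod_pair//.
by rewrite -big_mkcond/= (big_pred1 i).
Qed.

(** Dividing by the probability makes the single-sample estimate of
    [\sum_j x j] unbiased. *)
Lemma importance_mean (R : realType) (k : nat) (p : {ffun 'I_k -> R})
    (x : 'I_k -> R) :
  sampling_prob p -> \sum_l p l * (\sum_j x j - (p l)^-1 * x l) = 0.
Proof.
case=> p0 p1; under eq_bigr => l _ do
  rewrite mulrBr mulrA divff ?gt_eqF// mul1r.
by rewrite sumrB -mulr_suml p1 mul1r subrr.
Qed.

(** The variance of the single-sample estimate.  It serves twice: for the
    entries of the block products it gives the expected error, and for their
    norms it exhibits the excess over the optimal cost as a sum of
    nonnegative terms. *)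
Lemma importance_variance (R : realType) (k : nat) (p : {ffun 'I_k -> R})
    (x : 'I_k -> R) :
  sampling_prob p ->
  \sum_l p l * (\sum_j x j - (p l)^-1 * x l) ^+ 2 =
  \sum_l (p l)^-1 * x l ^+ 2 - (\sum_j x j) ^+ 2.
Proof.
case=> p0 p1; set M := \sum_j x j.
transitivity (\sum_l (p l * M ^+ 2 - x l * (2 * M) + (p l)^-1 * x l ^+ 2)).
  by apply: eq_bigr => l _; field; rewrite gt_eqF.
rewrite big_split sumrB/= -!mulr_suml p1 -/M; ring.
Qed.

(** The squared norm is a sum over the entries, and in each entry the error is
    the average of [c] independent centred variables. *)
Lemma expected_sq_errorE (R : realType) (m n rho k c : nat)
    (A : 'M[R]_(m, n)) (B : 'M[R]_(n, rho)) (Theta : 'I_k -> {set 'I_n})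
    (p : {ffun 'I_k -> R}) (d : measure_display) (Omega : measurableType d)
    (P : probability Omega R) (r : 'I_c -> Omega -> 'I_k) :
  (0 < c)%N -> labelled_partition Theta -> sampling_prob p ->
  iid_samples P r p ->
  expected_sq_error P A B Theta p r =
    (c%:R^-1 * (\sum_(l < k) (p l)^-1 * frobenius (block_mul (Theta l) A B) ^+ 2
                - frobenius (A *m B) ^+ 2))%:E.
Proof.
move=> c0 ThetaP pP riid.
have cN0 : c%:R != 0 :> R by rewrite pnatr_eq0 -lt0n.
pose x a b l := block_mul (Theta l) A B a b.
pose y a b l := \sum_j x a b j - (p l)^-1 * x a b l.
have ABE a b : (A *m B) a b = \sum_l x a b l.
  by rewrite -(sum_block_mul _ _ _ _ _ A B _ ThetaP) summxE.
have errE (s : 'I_c -> 'I_k) a b : (A *m B - estimator A B Theta p s) a b =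
    c%:R^-1 * \sum_(i < c) y a b (s i).
  rewrite mxE ABE mxE [X in - X]mxE summxE sumrB sumr_const card_ord.
  rewrite mulrBr -[X in _ * X - _]mulr_natl mulKf//.
  by congr (_ - _ * _); apply: eq_bigr => i _; rewrite mxE.
rewrite /expected_sq_error.
rewrite (@expectation_iid_samples _ _ _ _ _ _ _ p
  (fun s => frobenius (A *m B - estimator A B Theta p s) ^+ 2))//.
congr EFin.
transitivity (\sum_a \sum_b \sum_(s : {ffun 'I_c -> 'I_k})
    (\prod_(t < c) p (s t)) * (c%:R^-1 * \sum_(i < c) y a b (s i)) ^+ 2).
  under eq_bigr do rewrite frobenius_sq mulr_sumr.
  rewrite exchange_big; apply: eq_bigr => a _.
  under eq_bigr do rewrite mulr_sumr.
  rewrite exchange_big; apply: eq_bigr => b _.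
  by apply: eq_bigr => s _; rewrite errE.
transitivity (\sum_a \sum_b c%:R^-1 *
    (\sum_l (p l)^-1 * x a b l ^+ 2 - (A *m B) a b ^+ 2)).
  apply: eq_bigr => a _; apply: eq_bigr => b _.
  under eq_bigr do rewrite exprMn mulrCA.
  rewrite -mulr_sumr sum_prod_sq_sum; [|by case: pP|exact: importance_mean].
  by rewrite importance_variance// ABE; field.
under eq_bigr do rewrite -mulr_sumr sumrB.
rewrite -mulr_sumr sumrB -frobenius_sq; congr (_ * (_ - _)).
under eq_bigr do rewrite exchange_big.
rewrite exchange_big; apply: eq_bigr => l _.
rewrite frobenius_sq mulr_sumr; apply: eq_bigr => a _.
by rewrite mulr_sumr.
Qed.

Theorem proposition2p2 (R : realType) (m n rho k c : nat)
    (A : 'M[R]_(m, n)) (B : 'M[R]_(n, rho)) (Theta : 'I_k -> {set 'I_n})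
    (n_gt0 : (0 < n)%N) (c_ge1 : (1 <= c)%N)
    (ThetaP : labelled_partition Theta) :
  (forall p : {ffun 'I_k -> R}, sampling_prob p ->
   forall (d : measure_display) (Omega : measurableType d)
     (P : probability Omega R) (r : 'I_c -> Omega -> 'I_k),
     iid_samples P r p ->
     expected_sq_error P A B Theta p r =
       (c%:R^-1 * (\sum_(l < k) (p l)^-1 *
                     frobenius (block_mul (Theta l) A B) ^+ 2)
        - frobenius (A *m B) ^+ 2 / c%:R)%:E)
  /\
  ((forall l : 'I_k, block_mul (Theta l) A B <> 0) ->
   let q := optimal_prob A B Theta in
   [/\ sampling_prob q,
       forall p : {ffun 'I_k -> R}, sampling_prob p ->
       forall (d d' : measure_display)
         (Omega : measurableType d) (Omega' : measurableType d')
         (P : probability Omega R) (P' : probability Omega' R)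
         (r : 'I_c -> Omega -> 'I_k) (r' : 'I_c -> Omega' -> 'I_k),
         iid_samples P r q -> iid_samples P' r' p ->
         (expected_sq_error P A B Theta q r
            <= expected_sq_error P' A B Theta p r')%E /\
         (expected_sq_error P' A B Theta p r' =
            expected_sq_error P A B Theta q r -> p = q)
     & forall (d : measure_display) (Omega : measurableType d)
         (P : probability Omega R) (r : 'I_c -> Omega -> 'I_k),
         iid_samples P r q ->
         expected_sq_error P A B Theta q r =
           (c%:R^-1 * (\sum_(l < k) frobenius (block_mul (Theta l) A B)) ^+ 2
            - frobenius (A *m B) ^+ 2 / c%:R)%:E]).
Proof.
set f := fun l => frobenius (block_mul (Theta l) A B).
have err p : sampling_prob p -> forall d (Omega : measurableType d)
    (P : probability Omega R) (r : 'I_c -> Omega -> 'I_k),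
    iid_samples P r p -> expected_sq_error P A B Theta p r =
    (c%:R^-1 * (\sum_l (p l)^-1 * f l ^+ 2 - frobenius (A *m B) ^+ 2))%:E.
  by move=> pP d Omega P r; apply: expected_sq_errorE.
split=> [p pP d Omega P r /(err p pP) ->|C0 q].
  by rewrite mulrBr [_ / c%:R]mulrC.
have f0 l : 0 < f l by apply: frobenius_gt0.
(* The sum of the norms must be nonzero for [q] to be a probability; since
   [n] is positive, some block contains the first index. *)
have [l0 _] : exists l : 'I_k, True.
  case: (ThetaP) => _ /and3P[/eqP covT _ _].
  have : Ordinal n_gt0 \in finset.cover [set Theta l | l in 'I_k]%SET.
    by rewrite covT finset.in_setT.
  by case/bigcupP => _ /imsetP[l _ _] _; exists l.
pose F := \sum_l f l.
have F0 : 0 < F.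
  rewrite /F (bigD1 l0)//= ltr_pwDl//.
  by apply: sumr_ge0 => l _; apply/ltW.
have qE l : q l = f l / F by rewrite ffunE.
have qP : sampling_prob q.
  split=> [l|]; first by rewrite qE divr_gt0.
  by under eq_bigr do rewrite qE; rewrite -mulr_suml divff// gt_eqF.
have costq : \sum_l (q l)^-1 * f l ^+ 2 = F ^+ 2.
  transitivity (\sum_l f l * F); last by rewrite -mulr_suml expr2.
  by apply: eq_bigr => l _; rewrite qE; field; rewrite !gt_eqF.
have cV0 : 0 < c%:R^-1 :> R by rewrite invr_gt0 ltr0n.
split=> // [p pP d d' Omega Omega' P P' r r' rq rp|d Omega P r rq]; last first.
  by rewrite (err q)// costq mulrBr [_ / c%:R]mulrC.
(* The excess of the cost of [p] over that of [q]. *)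
have gap := importance_variance _ _ p f pP; rewrite -/F in gap.
have gap_ge0 l : 0 <= p l * (F - (p l)^-1 * f l) ^+ 2.
  by rewrite mulr_ge0 ?sqr_ge0//; case: pP => p0 _; apply/ltW.
rewrite (err q)// (err p)// costq; split.
  rewrite lee_fin ler_pM2l// lerD2r -subr_ge0 -gap.
  by apply: sumr_ge0 => l _.
move=> [] /(mulfI (lt0r_neq0 cV0))/addIr/eqP; rewrite -subr_eq0 -gap => /eqP gap0.
case: (pP) => p0 _.
apply/ffunP => l; rewrite qE.
have /eqP : p l * (F - (p l)^-1 * f l) ^+ 2 = 0 by apply: (psumr_eq0P _ gap0).
rewrite mulf_eq0 gt_eqF//= sqrf_eq0 subr_eq0 => /eqP ->.
by field; rewrite !gt_eqF.
Qed.
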